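(* Let $A=A_0+A_1\epsilon\in\mathbb{DQ}^{m\times n}$ and $B=B_0+B_1\epsilon\in\mathbb{DQ}^{m\times k}$ be given. Set $$B_{11}=B_1-A_1A_0^{\dagger}B_0,\quad A_{11}=A_1L_{A_0},\quad A_2=R_{A_0}A_{11},\quad C_2=R_{A_0}B_{11}.$$ Then the following are equivalent: (1) The dual quaternion matrix equation $AX=B$ is solvable (with $X\in\mathbb{DQ}^{n\times k}$). (2) $R_{A_0}B_0=0$ and $R_{A_2}C_2=0$. (3) $r\begin{bmatrix}A_0&B_0\end{bmatrix}=r(A_0)$ and $r\begin{bmatrix}A_0&B_1&A_1\\0&B_0&A_0\end{bmatrix}=r\begin{bmatrix}A_0&A_1\\0&A_0\end{bmatrix}$. In this situation, the general solution of $AX=B$ can be expressed as $X=X_0+X_1\epsilon$, where $$X_0=A_0^{\dagger}B_0+L_{A_0}W,\qquad X_1=A_0^{\dagger}(B_{11}-A_{11}W)+L_{A_0}W_1,\qquad W=A_2^{\dagger}C_2+L_{A_2}W_2,$$ and $W_1,W_2$ are arbitrary matrices over $\mathbb{H}$ of suitable dimensions.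
   Context: $\mathbb{H}$ denotes the real quaternions. The dual quaternions are $\mathbb{DQ}=\{c_0+c_1\epsilon: c_0,c_1\in\mathbb{H}\}$, where $\epsilon^2=0$ and $\epsilon$ commutes with quaternions; addition and multiplication are the resulting ones, e.g. $(a_0+a_1\epsilon)(b_0+b_1\epsilon)=a_0b_0+(a_0b_1+a_1b_0)\epsilon$. A dual quaternion matrix $A\in\mathbb{DQ}^{m\times n}$ is written uniquely as $A=A_0+A_1\epsilon$ with $A_0,A_1\in\mathbb{H}^{m\times n}$, and two such matrices are equal iff their two parts are equal. For a quaternion matrix $M\in\mathbb{H}^{m\times n}$: $r(M)$ is its rank; $M^*$ its conjugate transpose; $M^\dagger$ its Moore-Penrose inverse, i.e. the unique $X$ with $MXM=M$, $XMX=X$, $(MX)^*=MX$, $(XM)^*=XM$; and $L_M=I-M^\dagger M$, $R_M=I-MM^\dagger$. ''The general solution can be expressed as'' means that the solutions are exactly the matrices given by the formula as the arbitrary parameter matrices vary. *)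

(* Defs.v *)
From HB Require Import structures.
From mathcomp Require Import all_boot all_order all_algebra.
From mathcomp Require Import ring.
From mathcomp Require Import boolp classical_sets reals.

Set Implicit Arguments.
Unset Strict Implicit.
Unset Printing Implicit Defensive.

Import GRing.Theory.
Local Open Scope ring_scope.

(* [Quat a b c d] is a + b i + c j + d k. *)
Record quat (R : Type) := Quat { qre : R; qi : R; qj : R; qk : R }.

Section Quaternion.
Variable R : comNzRingType.
Implicit Types x y z : quat R.

Definition quat_tuple x := (qre x, qi x, qj x, qk x).
Definition tuple_quat (t : R * R * R * R) :=
  Quat t.1.1.1 t.1.1.2 t.1.2 t.2.

Lemma quat_tupleK : cancel quat_tuple tuple_quat.
Proof. by case. Qed.

HB.instance Definition _ := Choice.copy (quat R) (can_type quat_tupleK).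

Definition addq x y :=
  Quat (qre x + qre y) (qi x + qi y) (qj x + qj y) (qk x + qk y).

Definition oppq x := Quat (- qre x) (- qi x) (- qj x) (- qk x).

Definition mulq x y :=
  Quat (qre x * qre y - qi x * qi y - qj x * qj y - qk x * qk y)
       (qre x * qi y + qi x * qre y + qj x * qk y - qk x * qj y)
       (qre x * qj y - qi x * qk y + qj x * qre y + qk x * qi y)
       (qre x * qk y + qi x * qj y - qj x * qi y + qk x * qre y).

Definition qconj x := Quat (qre x) (- qi x) (- qj x) (- qk x).

Let zeroq : quat R := Quat 0 0 0 0.
Let oneq : quat R := Quat 1 0 0 0.

Lemma addqA : associative addq.
Proof. by move=> x y z; rewrite /addq /= !addrA. Qed.

Lemma addqC : commutative addq.
Proof. by move=> x y; congr Quat; rewrite /= addrC. Qed.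

Lemma add0q : left_id zeroq addq.
Proof. by case=> a b c d; rewrite /addq /= !add0r. Qed.

Lemma addNq : left_inverse zeroq oppq addq.
Proof. by case=> a b c d; rewrite /addq /= !addNr. Qed.

HB.instance Definition _ :=
  GRing.isZmodule.Build (quat R) addqA addqC add0q addNq.

Lemma mulqA : associative mulq.
Proof. by move=> x y z; congr Quat; rewrite /=; ring. Qed.

Lemma mul1q : left_id oneq mulq.
Proof. by case=> a b c d; congr Quat; rewrite /=; ring. Qed.

Lemma mulq1 : right_id oneq mulq.
Proof. by case=> a b c d; congr Quat; rewrite /=; ring. Qed.

Lemma mulqDl : left_distributive mulq addq.
Proof. by move=> x y z; congr Quat; rewrite /=; ring. Qed.

Lemma mulqDr : right_distributive mulq addq.
Proof. by move=> x y z; congr Quat; rewrite /=; ring. Qed.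

Lemma oneq_neq0 : oneq != zeroq.
Proof. by apply/eqP=> -[] /eqP; rewrite oner_eq0. Qed.

HB.instance Definition _ := GRing.Zmodule_isNzRing.Build (quat R)
  mulqA mul1q mulq1 mulqDl mulqDr oneq_neq0.

End Quaternion.

(* [Dual a b] is a + b epsilon. *)
Record dualnum (T : Type) := Dual { stdpart : T; epspart : T }.

Section DualNumbers.
Variable T : nzRingType.
Implicit Types x y z : dualnum T.

Definition dual_pair x := (stdpart x, epspart x).
Definition pair_dual (p : T * T) := Dual p.1 p.2.

Lemma dual_pairK : cancel dual_pair pair_dual.
Proof. by case. Qed.

HB.instance Definition _ := Choice.copy (dualnum T) (can_type dual_pairK).

Definition addd x y := Dual (stdpart x + stdpart y) (epspart x + epspart y).
Definition oppd x := Dual (- stdpart x) (- epspart x).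
Definition muld x y :=
  Dual (stdpart x * stdpart y) (stdpart x * epspart y + epspart x * stdpart y).

Let zerod : dualnum T := Dual 0 0.
Let oned : dualnum T := Dual 1 0.

Lemma adddA : associative addd.
Proof. by move=> x y z; rewrite /addd /= !addrA. Qed.

Lemma adddC : commutative addd.
Proof. by move=> x y; congr Dual; rewrite /= addrC. Qed.

Lemma add0d : left_id zerod addd.
Proof. by case=> a b; rewrite /addd /= !add0r. Qed.

Lemma addNd : left_inverse zerod oppd addd.
Proof. by case=> a b; rewrite /addd /= !addNr. Qed.

HB.instance Definition _ :=
  GRing.isZmodule.Build (dualnum T) adddA adddC add0d addNd.

Lemma muldA : associative muld.
Proof.
by move=> x y z; congr Dual; rewrite /= ?mulrDr ?mulrDl !mulrA ?addrA.
Qed.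

Lemma mul1d : left_id oned muld.
Proof. by case=> a b; rewrite /muld /= !mul1r mul0r addr0. Qed.

Lemma muld1 : right_id oned muld.
Proof. by case=> a b; rewrite /muld /= !mulr1 mulr0 add0r. Qed.

Lemma muldDl : left_distributive muld addd.
Proof. by move=> x y z; congr Dual; rewrite /= !mulrDl // addrACA. Qed.

Lemma muldDr : right_distributive muld addd.
Proof. by move=> x y z; congr Dual; rewrite /= !mulrDr // addrACA. Qed.

Lemma oned_neq0 : oned != zerod.
Proof. by apply/eqP=> -[] /eqP; rewrite oner_eq0. Qed.

HB.instance Definition _ := GRing.Zmodule_isNzRing.Build (dualnum T)
  muldA mul1d muld1 muldDl muldDr oned_neq0.

(* The matrix M0 + M1 epsilon. *)
Definition dualmx m n (M0 M1 : 'M[T]_(m, n)) : 'M[dualnum T]_(m, n) :=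
  map2_mx (@Dual T) M0 M1.

End DualNumbers.

Section QuaternionMatrices.
Variable R : realType.
Local Notation H := (quat R).

Definition conjtr m n (M : 'M[H]_(m, n)) : 'M[H]_(n, m) :=
  map_mx (@qconj R) M^T.

(* The columns of M with index in S are right linearly independent:
   in [M *m c] the coefficients multiply the columns on the right. *)
Definition right_free_cols m n (M : 'M[H]_(m, n)) (S : {set 'I_n}) : Prop :=
  forall c : 'cV[H]_n,
    (forall j, j \notin S -> c j ord0 = 0) -> M *m c = 0 -> c = 0.

(* MathComp's [\rank] requires a commutative field; over the quaternions the
   rank is the maximal number of right linearly independent columns. *)
Definition qrank m n (M : 'M[H]_(m, n)) : nat :=
  \max_(S : {set 'I_n} | `[< right_free_cols M S >]) #|S|.

Definition is_mpinv m n (M : 'M[H]_(m, n)) (X : 'M[H]_(n, m)) : Prop :=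
  [/\ M *m X *m M = M,
      X *m M *m X = X,
      conjtr (M *m X) = M *m X &
      conjtr (X *m M) = X *m M].

(* The default value 0 of [xget] is never used: every quaternion matrix has
   exactly one Moore-Penrose inverse. *)
Definition mpinv m n (M : 'M[H]_(m, n)) : 'M[H]_(n, m) :=
  xget 0 [set X | is_mpinv M X]%classic.

Definition Lproj m n (M : 'M[H]_(m, n)) : 'M[H]_n := 1%:M - mpinv M *m M.
Definition Rproj m n (M : 'M[H]_(m, n)) : 'M[H]_m := 1%:M - M *m mpinv M.

End QuaternionMatrices.

(* Main.v *)
Require Import Defs.
From mathcomp Require Import all_boot all_order all_algebra.
From mathcomp Require Import boolp reals.
From mathcomp Require classical_sets.
From mathcomp Require Import ring.

Import Order.TTheory GRing.Theory Num.Theory.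

(** Comparing the two parts of AX = B turns it into a pair of quaternion
    equations, A0 X0 = B0 and A0 X1 = B1 - A1 X0.  A quaternion equation
    MX = N is solvable iff R_M N = 0, and then X = M^+ N + L_M W
    ([mulmx_eqP]).  Solving the first equation for X0 leaves a parameter W;
    the second is then solvable for X1 iff R_{A0} (B11 - A11 W) = 0, that is
    A2 W = C2, which is an equation of the same kind for W.  So three
    applications of [mulmx_eqP] give both the condition on the projections and
    the general solution.

    The rank condition is compared with solvability directly.  The pair of
    equations says that (B1; B0) is a right combination of the columns of
    [A0 A1; 0 A0] with coefficients (X1; X0), so it holds iff inserting the
    columns (B1; B0) does not increase the rank of that matrix.

    Two facts on quaternion matrices carry all this.  First, Moore-Penrose
    inverses exist ([mpinv_exists]).  Gram-Schmidt, adding one column at a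
    time, gives a G such that MG is the orthogonal projector on the column
    space of M; it only divides by squared lengths of vectors, which are real,
    hence central.  Doing the same for the conjugate transpose of M and
    combining the two results yields the Moore-Penrose inverse.

    Second, equality of ranks detects equality of column spaces
    ([eq_qrank_range]).  The real part of the trace satisfies
    Re tr(XY) = Re tr(YX), because Re(xy) = Re(yx) for quaternions, and
    qrank M = Re tr(M M^+) ([qrank_retrace]).  If the column space of M
    contains that of N, then D = M M^+ - N N^+ is a Hermitian idempotent, so
    Re tr D = Re tr(D^* D) is the sum of the squared norms of the entries of
    D: it is nonnegative and vanishes only when the two projectors agree.
    This also replaces exchange arguments for linear independence over a
    skew field. *)

Local Open Scope ring_scope.

(** * Quaternions and the real part of the trace *)

Section QuaternionLinearAlgebra.
Set Implicit Arguments.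
Unset Strict Implicit.
Variable R : realType.
Local Notation H := (quat R).

Definition qreal (r : R) : H := Quat r 0 0 0.

Definition qnormsq (x : H) : R :=
  qre x ^+ 2 + qi x ^+ 2 + qj x ^+ 2 + qk x ^+ 2.

Definition retrace n (M : 'M[H]_n) : R := qre (\tr M).

Lemma qconjK : involutive (@qconj R).
Proof. by case=> a b c d; rewrite /qconj /= !opprK. Qed.

Lemma qconjM (x y : H) : qconj (x * y) = qconj y * qconj x.
Proof. by congr Quat; rewrite /=; ring. Qed.

Lemma qconjD (x y : H) : qconj (x + y) = qconj x + qconj y.
Proof. by congr Quat; rewrite /=; ring. Qed.

Lemma qconjN (x : H) : qconj (- x) = - qconj x.
Proof. by []. Qed.

Lemma qconj_real (r : R) : qconj (qreal r) = qreal r.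
Proof. by congr Quat; rewrite oppr0. Qed.

Lemma qconj_sum (I : Type) (r : seq I) (P : pred I) (F : I -> H) :
  qconj (\sum_(i <- r | P i) F i) = \sum_(i <- r | P i) qconj (F i).
Proof. by apply: (big_morph _ qconjD (qconj_real 0)). Qed.

Lemma qre_sum (I : Type) (r : seq I) (P : pred I) (F : I -> H) :
  qre (\sum_(i <- r | P i) F i) = \sum_(i <- r | P i) qre (F i).
Proof. exact: (@big_morph _ _ (@qre R) 0 +%R). Qed.

Lemma qrealM (r s : R) : qreal (r * s) = qreal r * qreal s.
Proof. by congr Quat; rewrite /=; ring. Qed.

Lemma qreal_sum (I : Type) (r : seq I) (P : pred I) (F : I -> R) :
  \sum_(i <- r | P i) qreal (F i) = qreal (\sum_(i <- r | P i) F i).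
Proof.
by apply/esym/(big_morph qreal) => // x y; congr Quat; rewrite /= addr0.
Qed.

Lemma mul_qconjl (x : H) : qconj x * x = qreal (qnormsq x).
Proof. by rewrite /qnormsq; congr Quat; rewrite /=; ring. Qed.

Lemma mul_qconjr (x : H) : x * qconj x = qreal (qnormsq x).
Proof. by rewrite /qnormsq; congr Quat; rewrite /=; ring. Qed.

Lemma qre_mulC (x y : H) : qre (x * y) = qre (y * x).
Proof. by rewrite /=; ring. Qed.

Lemma qnormsq_ge0 (x : H) : 0 <= qnormsq x.
Proof. by rewrite /qnormsq !addr_ge0 ?sqr_ge0. Qed.

Lemma qnormsq_eq0 (x : H) : (qnormsq x == 0) = (x == 0).
Proof.
apply/idP/eqP=> [|->]; last by rewrite /qnormsq /= expr0n /= !addr0.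
rewrite /qnormsq !paddr_eq0 ?addr_ge0 ?sqr_ge0 // !sqrf_eq0.
by case: x => a b c d /= /andP[/andP[/andP[/eqP-> /eqP->] /eqP->] /eqP->].
Qed.

Lemma qmul_eq0l (x y : H) : x * y = 0 -> y != 0 -> x = 0.
Proof.
rewrite -qnormsq_eq0 => xy0 y0.
rewrite -[x]mulr1 (_ : 1 = qreal 1) // -(mulfV y0) qrealM.
by rewrite -mul_qconjr !mulrA xy0 !mul0r.
Qed.

Lemma conjtrE m n (M : 'M[H]_(m, n)) i j : conjtr M i j = qconj (M j i).
Proof. by rewrite !mxE. Qed.

Lemma conjtrK m n (M : 'M[H]_(m, n)) : conjtr (conjtr M) = M.
Proof. by apply/matrixP=> i j; rewrite !conjtrE qconjK. Qed.

Lemma conjtrM m n p (M : 'M[H]_(m, n)) (N : 'M[H]_(n, p)) :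
  conjtr (M *m N) = conjtr N *m conjtr M.
Proof.
apply/matrixP=> i j; rewrite conjtrE !mxE qconj_sum.
by apply: eq_bigr => l _; rewrite qconjM !conjtrE.
Qed.

Lemma conjtrD m n (M N : 'M[H]_(m, n)) :
  conjtr (M + N) = conjtr M + conjtr N.
Proof. by apply/matrixP=> i j; rewrite !(conjtrE, mxE) qconjD. Qed.

Lemma conjtrN m n (M : 'M[H]_(m, n)) : conjtr (- M) = - conjtr M.
Proof. by apply/matrixP=> i j; rewrite !(conjtrE, mxE) qconjN. Qed.

Lemma conjtr0 m n : conjtr (0 : 'M[H]_(m, n)) = 0.
Proof. by apply/matrixP=> i j; rewrite conjtrE !mxE qconj_real. Qed.

Lemma conjtr_real (r : R) : conjtr ((qreal r)%:M : 'M[H]_1) = (qreal r)%:M.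
Proof.
by apply/matrixP=> i j; rewrite conjtrE !mxE !ord1 /= mulr1n qconj_real.
Qed.

Lemma conjtr_gram m n (M : 'M[H]_(m, n)) i :
  (conjtr M *m M) i i = qreal (\sum_l qnormsq (M l i)).
Proof.
by rewrite mxE -qreal_sum; apply: eq_bigr => l _; rewrite conjtrE mul_qconjl.
Qed.

(** The trace itself is not cyclic over the quaternions; its real part is,
    because Re(xy) = Re(yx). *)
Lemma retraceC m n (M : 'M[H]_(m, n)) (N : 'M[H]_(n, m)) :
  retrace (M *m N) = retrace (N *m M).
Proof.
rewrite /retrace /mxtrace !qre_sum.
under eq_bigr do rewrite mxE qre_sum.
under [RHS]eq_bigr do rewrite mxE qre_sum.
rewrite exchange_big; apply: eq_bigr => i _; apply: eq_bigr => j _.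
exact: qre_mulC.
Qed.

Lemma retraceB n (M N : 'M[H]_n) : retrace (M - N) = retrace M - retrace N.
Proof. by rewrite /retrace raddfB. Qed.

(** Re tr(M^* M) is the squared Frobenius norm, hence definite. *)
Lemma retrace_gram m n (M : 'M[H]_(m, n)) :
  retrace (conjtr M *m M) = \sum_i \sum_l qnormsq (M l i).
Proof.
by rewrite /retrace /mxtrace qre_sum; under eq_bigr do rewrite conjtr_gram.
Qed.

Lemma retrace_gram_ge0 m n (M : 'M[H]_(m, n)) : 0 <= retrace (conjtr M *m M).
Proof.
rewrite retrace_gram; apply: sumr_ge0 => i _; apply: sumr_ge0 => l _.
exact: qnormsq_ge0.
Qed.

Lemma retrace_gram_eq0 m n (M : 'M[H]_(m, n)) :
  retrace (conjtr M *m M) = 0 -> M = 0.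
Proof.
have ge0 (i : 'I_n) : 0 <= \sum_l qnormsq (M l i).
  by apply: sumr_ge0 => l _; exact: qnormsq_ge0.
rewrite retrace_gram => /(psumr_eq0P (fun i _ => ge0 i)) M0.
apply/matrixP=> l i; rewrite mxE; apply/eqP; rewrite -qnormsq_eq0.
have /psumr_eq0P -> // := M0 i isT.
by move=> *; exact: qnormsq_ge0.
Qed.

(** * Existence of Moore-Penrose inverses *)

(** The normalization of Gram-Schmidt: r is the inverse of the squared length
    of u, and r u u^* is the orthogonal projector on the line of u.  For u = 0
    the convention that 0 has inverse 0 makes it the zero projector, so that no
    case distinction is needed later. *)
Lemma cvec_gram_inv m (u : 'cV[H]_m) :
  exists r : R, u *m (qreal r)%:M *m conjtr u *m u = u.
Proof.
set s := \sum_l qnormsq (u l ord0).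
have uu : conjtr u *m u = (qreal s)%:M.
  by apply/matrixP=> i j; rewrite !ord1 conjtr_gram !mxE /= mulr1n.
exists s^-1; rewrite -!mulmxA uu.
have [s0|s0] := eqVneq s 0.
  suff -> : u = 0 by rewrite !mul0mx.
  apply: retrace_gram_eq0.
  by rewrite uu /retrace mxtrace_scalar /= s0.
by rewrite -scalar_mxM -qrealM mulVf // mulmx1.
Qed.

(** Such a G makes MG the orthogonal projector on the column space of M.  For
    a matrix [v N], let P = NG be the projector for N, and u = v - Pv the
    component of v orthogonal to the columns of N; then P + u q projects on the
    columns of [v N], where q = r u^* is the normalized row of u. *)
Lemma ls_inverse_exists m n (M : 'M[H]_(m, n)) :
  exists G, M *m G *m M = M /\ conjtr (M *m G) = M *m G.
Proof.
elim: n => [|n IHn] in M *.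
  exists 0; rewrite mulmx0 mul0mx; split; last exact: conjtr0.
  by apply/matrixP=> i [].
rewrite -[n.+1]/(1 + n)%N in M *; rewrite -[M]hsubmxK.
set v := lsubmx _; set N := rsubmx _.
have [G [NGN NGh]] := IHn N.
set u := v - N *m G *m v.
have Nu : conjtr u *m N = 0.
  have Pu : N *m G *m u = 0 by rewrite mulmxBr !mulmxA NGN subrr.
  by rewrite -[in LHS]NGN mulmxA -NGh -conjtrM Pu conjtr0 mul0mx.
have [r ur] := cvec_gram_inv u; set q := (qreal r)%:M *m conjtr u.
have qN : q *m N = 0 by rewrite -mulmxA Nu mulmx0.
have uqv : u *m q *m v = u.
  have -> : v = u + N *m (G *m v) by rewrite mulmxA subrK.
  rewrite mulmxDr (mulmxA _ N) -(mulmxA u q N) qN mulmx0 mul0mx addr0.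
  by rewrite /q mulmxA.
(* chosen so that [v N] G' = N G + (v - N G v) q = N G + u q *)
exists (col_mx q (G - G *m v *m q)).
have -> : row_mx v N *m col_mx q (G - G *m v *m q) = N *m G + u *m q.
  by rewrite mul_row_col mulmxBr mulmxBl !mulmxA addrC addrAC addrA.
split.
  rewrite mul_mx_row !(mulmxDl _ (u *m q)) uqv NGN -(mulmxA u) qN mulmx0 addr0.
  by rewrite addrC subrK.
by rewrite conjtrD NGh !conjtrM conjtrK conjtr_real mulmxA.
Qed.

(** If MG projects on the column space of M, and G' does the same for M^*, so
    that KM with K = G'^* is Hermitian and MKM = M, then KMG is the
    Moore-Penrose inverse. *)
Lemma mpinv_exists m n (M : 'M[H]_(m, n)) : exists X, is_mpinv M X.
Proof.
have [G [MGM MGh]] := ls_inverse_exists M.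
have [G' [MG'M MG'h]] := ls_inverse_exists (conjtr M).
set K := conjtr G'.
have MKM : M *m K *m M = M.
  by rewrite -mulmxA -[RHS]conjtrK -MG'M !conjtrM !conjtrK.
have KMh : conjtr (K *m M) = K *m M.
  by rewrite conjtrM conjtrK -{1}MG'h conjtrM conjtrK.
have KMGM : K *m M *m G *m M = K *m M.
  by rewrite -(mulmxA K M G) -(mulmxA K (M *m G)) MGM.
exists (K *m M *m G); split; rewrite ?mulmxA.
- by rewrite MKM.
- by rewrite KMGM -(mulmxA K M K) -(mulmxA K (M *m K)) MKM.
- by rewrite MKM.
- by rewrite KMGM.
Qed.

Lemma mpinvP m n (M : 'M[H]_(m, n)) : is_mpinv M (mpinv M).
Proof.
exact: (@classical_sets.xgetPex _ 0 (is_mpinv M) (mpinv_exists M)).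
Qed.

(** * The rank as the trace of the range projector *)

Definition rangeproj m n (M : 'M[H]_(m, n)) : 'M[H]_m := M *m mpinv M.

Lemma rangeproj_herm m n (M : 'M[H]_(m, n)) :
  conjtr (rangeproj M) = rangeproj M.
Proof. by case: (mpinvP M). Qed.

Lemma rangeprojK m n (M : 'M[H]_(m, n)) : rangeproj M *m M = M.
Proof. by case: (mpinvP M). Qed.

Lemma rangeprojP m n p (M : 'M[H]_(m, n)) (N : 'M[H]_(m, p)) :
  (exists X, N = M *m X) <-> rangeproj M *m N = N.
Proof.
split=> [[X ->]|<-]; first by rewrite mulmxA rangeprojK.
by exists (mpinv M *m N); rewrite mulmxA.
Qed.

(** Orthogonal projectors on nested subspaces commute, so their difference is
    again Hermitian and idempotent. *)
Lemma rangeprojB_gram m n p (M : 'M[H]_(m, n)) (N : 'M[H]_(m, p)) :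
  rangeproj M *m N = N ->
  let D := rangeproj M - rangeproj N in conjtr D *m D = D.
Proof.
move=> MN D.
have PQ : rangeproj M *m rangeproj N = rangeproj N by rewrite mulmxA MN.
have QP : rangeproj N *m rangeproj M = rangeproj N.
  by rewrite -[RHS]rangeproj_herm -[in RHS]PQ conjtrM !rangeproj_herm.
have idem q (L : 'M[H]_(m, q)) : rangeproj L *m rangeproj L = rangeproj L.
  by rewrite mulmxA rangeprojK.
rewrite /D conjtrD conjtrN !rangeproj_herm mulmxBl !mulmxBr PQ QP !idem.
by rewrite subrr subr0.
Qed.

Lemma le_retrace_rangeproj m n p (M : 'M[H]_(m, n)) (N : 'M[H]_(m, p)) :
  rangeproj M *m N = N -> retrace (rangeproj N) <= retrace (rangeproj M).
Proof.
move=> /rangeprojB_gram E.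
by rewrite -subr_ge0 -retraceB -E retrace_gram_ge0.
Qed.

Lemma eq_retrace_rangeproj m n p (M : 'M[H]_(m, n)) (N : 'M[H]_(m, p)) :
  rangeproj M *m N = N -> retrace (rangeproj M) = retrace (rangeproj N) ->
  rangeproj M = rangeproj N.
Proof.
move=> /rangeprojB_gram E tr_eq; apply/eqP; rewrite -subr_eq0; apply/eqP.
by apply: retrace_gram_eq0; rewrite E retraceB tr_eq subrr.
Qed.

Definition colmask n (S : {set 'I_n}) : 'M[H]_n :=
  diag_mx (\row_j (j \in S)%:R).

Lemma mul_colmask n p (S : {set 'I_n}) (M : 'M[H]_(n, p)) i j :
  (colmask S *m M) i j = (i \in S)%:R * M i j.
Proof. by rewrite mul_diag_mx !mxE. Qed.

Lemma mul_mx_colmask m n (S : {set 'I_n}) (M : 'M[H]_(m, n)) i j :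
  (M *m colmask S) i j = M i j * (j \in S)%:R.
Proof. by rewrite mul_mx_diag !mxE. Qed.

Lemma conjtr_colmask n (S : {set 'I_n}) : conjtr (colmask S) = colmask S.
Proof.
apply/matrixP=> i j; rewrite conjtrE !mxE eq_sym.
have [->|_] := eqVneq; last by rewrite !mulr0n qconj_real.
by rewrite mulr1n; case: (j \in S); rewrite qconj_real.
Qed.

Lemma retrace_colmask n (S : {set 'I_n}) : retrace (colmask S) = #|S|%:R.
Proof.
rewrite /retrace mxtrace_diag qre_sum -sum1_card natr_sum [RHS]big_mkcond /=.
by apply: eq_bigr => j _; rewrite mxE; case: (j \in S).
Qed.

(** Let F be M with the columns outside S replaced by 0.  Freeness means that
    F has the same kernel as the diagonal projector D of S; as F^+ F is the
    orthogonal projector along the kernel of F, it equals D, and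
    Re tr(F F^+) = Re tr(F^+ F) = Re tr D. *)
Lemma retrace_free_cols m n (M : 'M[H]_(m, n)) (S : {set 'I_n}) :
  right_free_cols M S ->
  retrace (rangeproj (M *m colmask S)) = #|S|%:R.
Proof.
move=> freeS; set D := colmask S; set F := M *m D; set Q := mpinv F *m F.
have DD : D *m D = D.
  apply/matrixP=> i j; rewrite mul_colmask !mxE.
  have [->|_] := eqVneq i j; last by rewrite mulr0n mulr0.
  by rewrite mulr1n; case: (j \in S); rewrite (mul1r, mul0r).
have DQ : D *m Q = D.
  apply/eqP; rewrite -subr_eq0; apply/eqP/matrixP=> i j.
  set E := D *m Q - D.
  suff /matrixP/(_ i ord0) : col j E = 0 by rewrite !mxE.
  (* the columns of E are supported in S and killed by M, since F Q = F *)
  apply: freeS => [l /negPf lS|].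
    by rewrite /E -[X in _ - X]mulmx1 -mulmxBr mxE mul_colmask lS mul0r.
  rewrite colE mulmxA /E mulmxBr mulmxA -/F /Q mulmxA.
  by have [-> _ _ _] := mpinvP F; rewrite subrr mul0mx.
have QD : Q *m D = D.
  have Qh : conjtr Q = Q by case: (mpinvP F).
  by rewrite -{1}[D]conjtr_colmask -{1}Qh -conjtrM DQ conjtr_colmask.
have QDQ : Q *m D = Q by rewrite /Q -mulmxA /F -(mulmxA M) DD.
by rewrite /rangeproj retraceC -/F -/Q -QDQ QD retrace_colmask.
Qed.

(** Let U be M minus its projection on the span of the columns in S.  Its
    columns in S are zero, so a relation c between the columns of M in j |: S
    gives U_j c_j = 0.  If U_j were nonzero this would force c_j = 0, and
    j |: S would be a larger free set. *)
Lemma max_free_cols_span m n (M : 'M[H]_(m, n)) (S : {set 'I_n}) :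
  right_free_cols M S ->
  (forall T, right_free_cols M T -> (#|T| <= #|S|)%N) ->
  rangeproj (M *m colmask S) *m M = M.
Proof.
move=> freeS maxS; set F := M *m colmask S.
apply/eqP; rewrite eq_sym -subr_eq0; set U := _ - _.
have US i l : l \in S -> U i l = 0.
  move=> lS; have := mul_mx_colmask S U i l; rewrite lS mulr1 => <-.
  by rewrite mulmxBl -mulmxA -/F rangeprojK subrr mxE.
apply/eqP/matrixP=> i j; rewrite [RHS]mxE.
have [/US //|jS] := boolP (j \in S).
apply/eqP/negPn/negP=> Uij.
suff /maxS : right_free_cols M (j |: S) by rewrite cardsU1 jS ltnn.
move=> c c_supp Mc.
have Uc : U *m c = 0 by rewrite mulmxBl -mulmxA Mc mulmx0 subrr.
have cj : c j ord0 = 0.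
  apply/eqP/negPn/negP=> /(@qmul_eq0l (U i j)) Uij0.
  case/eqP: Uij; apply: Uij0; have : (U *m c) i ord0 = 0 by rewrite Uc mxE.
  rewrite mxE (bigD1 j) //= big1 ?addr0 // => l lj.
  have [/US->|lS] := boolP (l \in S); first by rewrite mul0r.
  by rewrite c_supp ?mulr0 // !inE negb_or lj.
apply: freeS => // l lS; have [->//|lj] := eqVneq l j.
by apply: c_supp; rewrite !inE negb_or lj.
Qed.

(** Both sides are computed from a free set of maximal size, whose columns span
    the column space of M. *)
Lemma qrank_retrace m n (M : 'M[H]_(m, n)) :
  (qrank M)%:R = retrace (rangeproj M).
Proof.
have free0 : right_free_cols M set0.
  by move=> c c0 _; apply/colP=> j; rewrite c0 ?inE // mxE.
have [|S /asboolP freeS qS] := @eq_bigmax_cond _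
    [pred T : {set 'I_n} | `[< right_free_cols M T >]] (fun T => #|T|).
  by apply/card_gt0P; exists set0; apply/asboolP.
have spanS : rangeproj (M *m colmask S) *m M = M.
  apply: max_free_cols_span => // T freeT; rewrite -qS.
  by apply: (leq_bigmax_cond (F := fun T : {set 'I_n} => #|T|)); apply/asboolP.
rewrite /qrank qS -(retrace_free_cols freeS); congr retrace.
apply: eq_retrace_rangeproj => //; apply/le_anti.
rewrite !le_retrace_rangeproj //.
by apply/rangeprojP; exists (colmask S).
Qed.

(** The trace formula for the rank turns equal ranks into equal traces of two
    nested range projectors, which then agree. *)
Lemma eq_qrank_range m n p (M : 'M[H]_(m, n)) (N : 'M[H]_(m, p)) :
  (exists X, N = M *m X) ->
  qrank M = qrank N <-> (exists Y, M = N *m Y).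
Proof.
move=> /rangeprojP MN; split=> [eq_rank|/rangeprojP NM].
  apply/rangeprojP; rewrite -(eq_retrace_rangeproj MN) ?rangeprojK //.
  by rewrite -!qrank_retrace eq_rank.
apply/eqP; rewrite -(eqr_nat R) !qrank_retrace.
by apply/eqP/le_anti; rewrite !le_retrace_rangeproj.
Qed.

Lemma eq_qrank_row m n p (M : 'M[H]_(m, n)) (N : 'M[H]_(m, p)) :
  qrank (row_mx M N) = qrank M <-> exists Y, M *m Y = N.
Proof.
rewrite eq_qrank_range; last first.
  by exists (col_mx 1%:M 0); rewrite mul_row_col mulmx1 mulmx0 addr0.
split=> -[Y].
  by rewrite -[Y]hsubmxK mul_mx_row => /eq_row_mx[_ ->]; exists (rsubmx Y).
by move=> <-; exists (row_mx 1%:M Y); rewrite mul_mx_row mulmx1.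
Qed.

Lemma eq_qrank_row_mid m n p q
    (M : 'M[H]_(m, n)) (N : 'M[H]_(m, p)) (L : 'M[H]_(m, q)) :
  qrank (row_mx M (row_mx N L)) = qrank (row_mx M L) <->
  exists Y, row_mx M L *m Y = N.
Proof.
rewrite eq_qrank_range; last first.
  exists (col_mx (row_mx 1%:M 0) (row_mx 0 (col_mx 0 1%:M))).
  rewrite mul_row_col !mul_mx_row !mul_row_col !mulmx0 !mulmx1.
  by rewrite add_row_mx addr0 !add0r.
split=> -[Y].
  rewrite -[Y]hsubmxK mul_mx_row => /eq_row_mx[_].
  rewrite -[rsubmx Y]hsubmxK mul_mx_row => /eq_row_mx[-> _].
  by exists (lsubmx (rsubmx Y)).
move=> <-; exists (row_mx (col_mx 1%:M 0) (row_mx Y (col_mx 0 1%:M))).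
by rewrite !mul_mx_row !mul_row_col !mulmx1 !mulmx0 addr0 add0r.
Qed.

(** * Linear equations over quaternions and dual quaternions *)

Lemma mulmx_eqP m n p (M : 'M[H]_(m, n)) (B : 'M[H]_(m, p)) X :
  M *m X = B <->
  Rproj M *m B = 0 /\ exists W, X = mpinv M *m B + Lproj M *m W.
Proof.
have ML : M *m Lproj M = 0.
  by rewrite mulmxBr mulmx1 mulmxA rangeprojK subrr.
split=> [<-|[/eqP]].
  split; first by rewrite mulmxA mulmxBl mul1mx rangeprojK subrr mul0mx.
  (* a solution X is itself a parameter that produces X *)
  by exists X; rewrite mulmxBl mul1mx mulmxA addrC subrK.
rewrite mulmxBl mul1mx subr_eq0 => /eqP MB [W ->].
by rewrite mulmxDr !mulmxA ML mul0mx addr0 -MB.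
Qed.

Lemma dualmx_surj m n (X : 'M[dualnum H]_(m, n)) :
  X = dualmx (map_mx (@stdpart H) X) (map_mx (@epspart H) X).
Proof. by apply/matrixP=> i j; rewrite !mxE; case: (X i j). Qed.

Lemma dualmx_inj m n (X0 X1 Y0 Y1 : 'M[H]_(m, n)) :
  dualmx X0 X1 = dualmx Y0 Y1 <-> X0 = Y0 /\ X1 = Y1.
Proof.
split=> [/matrixP XY|[-> ->] //].
by split; apply/matrixP=> i j; move: (XY i j); rewrite !mxE => -[].
Qed.

Lemma mul_dualmx m n p (A0 A1 : 'M[H]_(m, n)) (X0 X1 : 'M[H]_(n, p)) :
  dualmx A0 A1 *m dualmx X0 X1 =
  dualmx (A0 *m X0) (A0 *m X1 + A1 *m X0).
Proof.
have std : {morph (@stdpart H) : x y / x + y} by [].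
have eps : {morph (@epspart H) : x y / x + y} by [].
have ext (x y : dualnum H) :
  stdpart x = stdpart y -> epspart x = epspart y -> x = y.
  by case: x y => [? ?] [? ?] /= -> ->.
apply/matrixP=> i j; apply: ext; rewrite !mxE /=.
  rewrite (big_morph _ std (erefl : stdpart (0 : dualnum H) = 0)).
  by apply: eq_bigr => l _; rewrite !mxE.
rewrite (big_morph _ eps (erefl : epspart (0 : dualnum H) = 0)) -big_split /=.
by apply: eq_bigr => l _; rewrite !mxE.
Qed.

Lemma dual_mulmx_eqP m n p (A0 A1 : 'M[H]_(m, n)) (B0 B1 : 'M[H]_(m, p)) X0 X1 :
  dualmx A0 A1 *m dualmx X0 X1 = dualmx B0 B1 <->
  A0 *m X0 = B0 /\ A0 *m X1 = B1 - A1 *m X0.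
Proof.
rewrite mul_dualmx dualmx_inj; split=> -[-> E]; split=> //.
  by rewrite -E addrK.
by rewrite E subrK.
Qed.

(** The equation is the block system
    [A0 A1; 0 A0] (X1; X0) = (B1; B0) over the quaternions, whose lower row
    A0 X0 = B0 is what the first rank equation expresses. *)
Lemma dual_solvable_rankP m n p (A0 A1 : 'M[H]_(m, n)) (B0 B1 : 'M[H]_(m, p)) :
  (exists X, dualmx A0 A1 *m X = dualmx B0 B1) <->
  qrank (row_mx A0 B0) = qrank A0 /\
  qrank (col_mx (row_mx A0 (row_mx B1 A1)) (row_mx 0 (row_mx B0 A0)))
    = qrank (block_mx A0 A1 0 A0).
Proof.
have bigE : col_mx (row_mx A0 (row_mx B1 A1)) (row_mx 0 (row_mx B0 A0)) =
    row_mx (col_mx A0 0) (row_mx (col_mx B1 B0) (col_mx A1 A0)).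
  by rewrite -(block_mxEh B1) block_mxEv -block_mxEh block_mxEv.
rewrite bigE block_mxEh eq_qrank_row eq_qrank_row_mid -block_mxEh; split.
  case=> X; rewrite [X]dualmx_surj dual_mulmx_eqP.
  set X0 := map_mx _ X; set X1 := map_mx _ X; case=> E0 E1.
  split; first by exists X0.
  exists (col_mx X1 X0).
  by rewrite mul_block_col E1 subrK mul0mx add0r E0.
case=> _ [Y]; rewrite -[Y]vsubmxK mul_block_col mul0mx add0r.
case/eq_col_mx=> E1 E0; exists (dualmx (dsubmx Y) (usubmx Y)).
by apply/dual_mulmx_eqP; rewrite E0 -E1 addrK.
Qed.

End QuaternionLinearAlgebra.

Theorem corollary3p3 (R : realType) (m n k : nat)
    (A : 'M[dualnum (quat R)]_(m, n)) (B : 'M[dualnum (quat R)]_(m, k))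
    (A0 A1 : 'M[quat R]_(m, n)) (B0 B1 : 'M[quat R]_(m, k))
    (hA : A = dualmx A0 A1) (hB : B = dualmx B0 B1) :
  let B11 := B1 - A1 *m mpinv A0 *m B0 in
  let A11 := A1 *m Lproj A0 in
  let A2 := Rproj A0 *m A11 in
  let C2 := Rproj A0 *m B11 in
  let solvable := exists X : 'M[dualnum (quat R)]_(n, k), A *m X = B in
  let projection_condition :=
    Rproj A0 *m B0 = 0 /\ Rproj A2 *m C2 = 0 in
  let rank_condition :=
    qrank (row_mx A0 B0) = qrank A0 /\
    qrank (col_mx (row_mx A0 (row_mx B1 A1)) (row_mx 0 (row_mx B0 A0)))
      = qrank (block_mx A0 A1 0 A0) in
  [/\ solvable <-> projection_condition,
      projection_condition <-> rank_condition &
      solvable ->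
      forall X : 'M[dualnum (quat R)]_(n, k),
        A *m X = B <->
        exists W1 W2 : 'M[quat R]_(n, k),
          let W := mpinv A2 *m C2 + Lproj A2 *m W2 in
          let X0 := mpinv A0 *m B0 + Lproj A0 *m W in
          let X1 := mpinv A0 *m (B11 - A11 *m W) + Lproj A0 *m W1 in
          X = dualmx X0 X1].
Proof.
move=> B11 A11 A2 C2 solvable projection_condition rank_condition.
have solP (X : 'M[dualnum (quat R)]_(n, k)) : A *m X = B <->
  projection_condition /\ exists W1 W2 : 'M[quat R]_(n, k),
    let W := mpinv A2 *m C2 + Lproj A2 *m W2 in
    let X0 := mpinv A0 *m B0 + Lproj A0 *m W in
    let X1 := mpinv A0 *m (B11 - A11 *m W) + Lproj A0 *m W1 in
    X = dualmx X0 X1.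
  rewrite hA hB (dualmx_surj X) dual_mulmx_eqP.
  set X0 := map_mx _ X; set X1 := map_mx _ X.
  have rhsE W : B1 - A1 *m (mpinv A0 *m B0 + Lproj A0 *m W) = B11 - A11 *m W.
    by rewrite /B11 /A11 mulmxDr !mulmxA opprD addrA.
  (* solvability of the equation for X1 is a linear equation for W *)
  have compatE W : Rproj A0 *m (B11 - A11 *m W) = 0 <-> A2 *m W = C2.
    rewrite mulmxBr mulmxA -/A2 -/C2; split=> [/eqP|->]; last exact: subrr.
    by rewrite subr_eq0 => /eqP.
  split.
    case=> /mulmx_eqP[RB0 [W X0E]]; rewrite X0E rhsE.
    case/mulmx_eqP=> /compatE/mulmx_eqP[RC2 [W2 ->]] [W1 ->].
    by split=> //; exists W1, W2.
  case=> -[RB0 RC2] [W1 [W2 /= /dualmx_inj[-> ->]]]; split.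
    by apply/mulmx_eqP; split=> //; eexists.
  rewrite rhsE; apply/mulmx_eqP; split; last by eexists.
  by apply/compatE/mulmx_eqP; split=> //; eexists.
have solvable_proj : solvable <-> projection_condition.
  split=> [[X /solP[]] //|proj].
  by eexists; apply/solP; split=> //; exists 0, 0.
split=> //.
  by rewrite -solvable_proj /solvable hA hB; exact: dual_solvable_rankP.
by move=> /solvable_proj proj X; rewrite solP; split=> [[]|].
Qed.
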